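(* Let $a>b\ge 2$ be integers and let $F=P_a\cup P_b$ be the vertex-disjoint union of a path on $a$ vertices and a path on $b$ vertices. Let $G_F(n)$ be the $n$-vertex graph consisting of a set $U$ of $\lfloor a/2\rfloor+\lfloor b/2\rfloor-1$ universal vertices (each adjacent to all other vertices), where the graph $G_F(n)-U$ on the remaining $n-|U|$ vertices consists of a single edge plus isolated vertices if both $a$ and $b$ are odd, and has no edges otherwise. Let $G$ be any $F$-free graph on $n$ vertices with $n\ge \binom{a}{\lfloor a/2\rfloor}^2a^4b^4$. Then $e(G)\le e(G_F(n))$, with equality only when $G\cong G_F(n)$.
   Context: $P_m$ denotes the path on $m$ vertices; $e(G)$ denotes the number of edges of $G$. A graph is $F$-free if it does not contain $F$ as a subgraph. *)

(* Defs.v *)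
From mathcomp Require Import all_boot all_order.
Set Implicit Arguments. Unset Strict Implicit. Unset Printing Implicit Defensive.

Definition simple_graph (T : finType) (e : rel T) : Prop :=
  symmetric e /\ irreflexive e.

Definition edge_count (T : finType) (e : rel T) : nat :=
  #|[set p : T * T | e p.1 p.2]|./2.

(* The forest F = P_a ∪ P_b on vertex set {0,...,a+b-1}: vertices 0..a-1 form
   a path on a vertices, vertices a..a+b-1 form a path on b vertices. *)
Definition PaPb_edge (a b : nat) (i j : nat) : bool :=
  ((j == i.+1) && (j < a)) || ((j == i.+1) && (a <= i) && (j < a + b)).

Definition contains_PaPb (T : finType) (e : rel T) (a b : nat) : Prop :=
  exists f : 'I_(a + b) -> T, injective f /\
    forall i j : 'I_(a + b), PaPb_edge a b i j -> e (f i) (f j).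

Definition PaPb_free (T : finType) (e : rel T) (a b : nat) : Prop :=
  ~ contains_PaPb e a b.

(* The extremal graph G_F(n) on vertex set 'I_n: vertices 0..k-1 are universal,
   k = a/2 + b/2 - 1 (floors); if a and b are both odd, additionally the single
   edge {k, k+1}; no other edges. *)
Definition GF_edge (a b n : nat) : rel 'I_n :=
  fun i j =>
    let k := (a./2 + b./2).-1 in
    (i != j) &&
    [|| (i < k)%N, (j < k)%N |
        odd a && odd b &&
        (((i == k :> nat) && (j == k.+1 :> nat)) ||
         ((i == k.+1 :> nat) && (j == k :> nat)))].

Definition graph_iso (T T' : finType) (e : rel T) (e' : rel T') : Prop :=
  exists f : T -> T', bijective f /\ forall x y, e' (f x) (f y) = e x y.

Arguments GF_edge : clear implicits.

(* Main.v *)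
Require Import Defs.
From mathcomp Require Import all_boot all_order zify.
Set Implicit Arguments. Unset Strict Implicit. Unset Printing Implicit Defensive.

(** Put [k := a/2 + b/2 - 1].  Suppose that [G] has at least as many edges as
    [G_F(n)], and choose a vertex set [S] maximising [e(S) - (k - 1/3) |S|];
    counting edges shows that [S] is large.  By maximality, in [G[S]] every degree
    is at least [k], adjacent vertices have degree sum at least [2k + 1], and every
    component has more than [2k] vertices, hence (Dirac) a path on [2k + 1 >= a]
    vertices; as [G] is [F]-free, [G[S]] is connected.  Let [Q] be a longest path
    of [G[S]]; it has between [2k + 1] and [2k + 3] vertices.

    No edge avoids [Q]: if [P] were a longest path off [Q], with ends [x] and [y]
    and [2 <= |P| <= k], the degree conditions would force the neighbours of one end,
    say [x], to occupy every second position of the middle part of [Q], leaving no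
    room for a neighbour of [y].  So each vertex off [Q] has [k] pairwise
    non-consecutive neighbours among at most [2k + 1] positions of [Q].  There are
    fewer than [(k + 1)^2] such patterns, so some [k]-set [U] has many common
    neighbours.  With [U] at hand, an edge of [G[S] - U] (two edges if [a] and [b]
    are both odd) would complete a copy of [F].  This bounds [e(S)], and comparing
    with the choice of [S] gives [S = V(G)] and [G = G_F(n)]. *)

(** * Paths *)

Definition gpath (T : finType) (e : rel T) (s : seq T) := uniq s && sorted e s.

Definition deg (T : finType) (e : rel T) (x : T) := #|[set y | e x y]|.

Section Paths.
Variables (T : finType) (e : rel T).
Implicit Types (s p q : seq T) (x y z : T).

Lemma sorted_catE x0 s1 s2 :
  sorted e (s1 ++ s2) =
  [&& sorted e s1, sorted e s2 &
      [|| nilp s1, nilp s2 | e (last x0 s1) (head x0 s2)]].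
Proof.
case: s1 => [|x s1] /=; first by rewrite andbT.
case: s2 => [|y s2] /=; first by rewrite cats0 andbT.
by rewrite cat_path /= [path e y s2 && _]andbC.
Qed.

Lemma gpath_cat x0 s1 s2 : s1 != [::] -> s2 != [::] ->
  gpath e (s1 ++ s2) =
  [&& gpath e s1, gpath e s2, ~~ has (mem s1) s2 & e (last x0 s1) (head x0 s2)].
Proof.
move=> n1 n2; rewrite /gpath cat_uniq (sorted_catE x0) /nilp !size_eq0.
rewrite (negbTE n1) (negbTE n2) /=.
case: (uniq s1) => //=; case: (sorted e s1) => /=; rewrite ?andbF //=.
by case: (uniq s2); rewrite ?andbF //=; case: (has _ _); rewrite ?andbF.
Qed.

Lemma gpath_cons2 x y s :
  gpath e [:: x, y & s] = [&& x \notin y :: s, e x y & gpath e (y :: s)].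
Proof. by rewrite /gpath /= -!andbA; case: (e x y); rewrite ?andbF. Qed.

Lemma gpath_take n s : gpath e s -> gpath e (take n s).
Proof. by case/andP=> u p; rewrite /gpath take_uniq ?take_sorted. Qed.

Lemma gpath_drop n s : gpath e s -> gpath e (drop n s).
Proof. by case/andP=> u p; rewrite /gpath drop_uniq ?drop_sorted. Qed.

Lemma contains_of_paths a b p q : 0 < a ->
  gpath e p -> gpath e q -> ~~ has (mem p) q ->
  a <= size p -> b <= size q -> contains_PaPb e a b.
Proof.
move=> a0 /andP[up sp] /andP[uq sq] dpq lap lbq.
case: p => [|x0 p0] in up sp dpq lap *; first by move: lap; rewrite leqn0 -(prednK a0).
set p := x0 :: p0 in up sp dpq lap *.
have szp : size (take a p) = a by rewrite size_takel.
have szq : size (take b q) = b by rewrite size_takel.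
pose r := take a p ++ take b q.
have szr : size r = a + b by rewrite size_cat szp szq.
have ur : uniq r.
  rewrite cat_uniq !take_uniq // andbT /=.
  apply/hasPn => z /mem_take zq; apply/negP => /mem_take zp.
  by case/negP: dpq; apply/hasP; exists z.
exists (fun i => nth x0 r i); split.
  move=> i j /eqP; rewrite nth_uniq ?szr ?ltn_ord // => /eqP h; exact: val_inj.
move=> i j /orP[/andP[/eqP -> ja]|/andP[/andP[/eqP ji ai] jb]].
  rewrite !nth_cat szp ja (ltnW ja).
  by apply: (sortedP x0 (take_sorted a sp)); rewrite szp.
rewrite !nth_cat szp ji !ltnNge ai (leq_trans ai (leqnSn i)) /= subSn //.
by apply: (sortedP x0 (take_sorted b sq)); rewrite szq; lia.
Qed.

Lemma longest_exists (P : pred (seq T)) m :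
  (exists s, P s) -> (forall s, P s -> size s <= m) ->
  exists s, P s /\ forall s', P s' -> size s' <= size s.
Proof.
move=> [s0 Ps0] bnd.
(* For a fixed length the tuples form a finite type, so [R] is boolean and a largest length can be
   extracted. *)
pose R n := [exists t : n.-tuple T, P t].
have exR : exists n, R n by exists (size s0); apply/existsP; exists (in_tuple s0).
have bR : forall n, R n -> n <= m.
  by move=> n /existsP[t Pt]; rewrite -(size_tuple t); apply: bnd.
case: (ex_maxnP exR bR) => n /existsP[t Pt] maxn.
exists t; split => // s' Ps'; rewrite size_tuple; apply: maxn.
by apply/existsP; exists (in_tuple s').
Qed.

Lemma gpath_size s : gpath e s -> size s <= #|T|.
Proof. by case/andP=> /card_uniqP <- _; apply: max_card. Qed.

Lemma deg_count x s : uniq s -> (forall z, e x z -> z \in s) ->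
  deg e x = count (e x) s.
Proof.
move=> us sub; rewrite -size_filter -(card_uniqP (filter_uniq (e x) us)).
apply: eq_card => z; rewrite inE mem_filter.
by case: (boolP (e x z)) => // /sub ->.
Qed.

(** Serves the rotation argument below: with [s1] and [s2] a path without its first and without its
    last vertex, the absence of a crossing pair of edges bounds the degree sum of the two ends. *)
Lemma count_pair_leq (p q : pred T) s1 s2 x0 : size s1 = size s2 ->
  (forall i, i < size s1 -> ~~ (p (nth x0 s1 i) && q (nth x0 s2 i))) ->
  count p s1 + count q s2 <= size s1.
Proof.
elim: s1 s2 => [|x s1 IH] [|y s2] //= [sz] H.
have := H 0 isT; have {}H : forall i, i < size s1 -> ~~ (p (nth x0 s1 i) && q (nth x0 s2 i)).
  by move=> i; apply: (H i.+1).
have := IH _ sz H; rewrite /=; case: (p x); case: (q y) => //=; lia.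
Qed.

Lemma connect_leave (A : {pred T}) x z : connect e x z -> x \in A -> z \notin A ->
  exists u v, [/\ u \in A, v \notin A & e u v].
Proof.
case/connectP=> p; elim: p x => [|y p IH] x /= pth zl xA zA; first by rewrite zl xA in zA.
case/andP: pth => exy pth.
case: (boolP (y \in A)) => yA; last by exists x, y.
exact: (IH y pth zl yA zA).
Qed.

Hypothesis symE : symmetric e.

Lemma gpath_rev s : gpath e (rev s) = gpath e s.
Proof.
rewrite /gpath rev_uniq rev_sorted; congr (_ && _).
by case: s => //= x s; apply: eq_path => u v; rewrite symE.
Qed.

Hypothesis irrE : irreflexive e.

(* Dirac: if a longest path had at most [2k] vertices, its vertex set would carry
   a cycle, and a vertex next to that cycle would give a longer path. *)
Lemma closed_long_path (C : {set T}) k :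
  (forall x, x \in C -> k <= deg e x) ->
  (forall x y, x \in C -> e x y -> y \in C) ->
  (forall x y, x \in C -> y \in C -> connect e x y) ->
  2 * k < #|C| ->
  exists s, [/\ gpath e s, all (mem C) s & 2 * k < size s].
Proof.
move=> degC clC conC cardC.
have /card_gt0P[c0 c0C] : 0 < #|C| by lia.
pose P s := gpath e s && all (mem C) s.
have [] := @longest_exists P #|T|.
- by exists [:: c0]; rewrite /P /= c0C.
- by move=> s /andP[/gpath_size].
move=> s [/andP[gs sC] maxs]; exists s; split => //.
rewrite ltnNge; apply/negP => les.
case: s => [|x s'] in gs sC maxs les *.
  by have := maxs [:: c0]; rewrite /P /= c0C => /(_ isT).
set s := x :: s' in gs sC maxs les *.
have def_s : s = rcons (belast x s') (last x s') by rewrite -lastI.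
set s'' := belast x s' in def_s; set y := last x s' in def_s.
have xC : x \in C by move/allP: sC; apply; rewrite inE eqxx.
have yC : y \in C by move/allP: sC; apply; rewrite def_s mem_rcons inE eqxx.
have us : uniq s by case/andP: gs.
have extend c : c \in C -> e c x -> c \in s.
  move=> cC ecx; apply/negPn/negP => cs.
  have := maxs (c :: s); rewrite /P gpath_cons2 -/s cs ecx gs /= cC.
  by move: sC => /= -> /(_ isT); rewrite ltnn.
have dx : deg e x = count (e x) s'.
  rewrite (@deg_count _ s) //= ?irrE // => z exz.
  by apply: extend; [apply: clC exz | rewrite symE].
have dy : deg e y = count (e y) s''.
  rewrite (@deg_count _ s) // => [|z eyz].
    by rewrite def_s -cats1 count_cat /= irrE !addn0.
  apply/negPn/negP => zs; have zC : z \in C by apply: clC eyz.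
  have Pz : P (s ++ [:: z]).
    by rewrite /P (gpath_cat x) // gs all_cat sC /= zC (negbTE zs) -/y eyz.
  by have := maxs _ Pz; rewrite size_cat addn1 ltnn.
have sz : size s' = size s'' by rewrite size_belast.
have sz1 : size s = (size s').+1 by [].
(* Without a position [i] such that [x] is adjacent to vertex [i + 1] of [s] and [y] to vertex [i],
   the end degrees sum to at most [size s - 1 < 2 * k]. *)
have [/forallP H|] := boolP [forall i : 'I_(size s'),
    ~~ (e x (nth x s' i) && e y (nth x s'' i))].
  have := @count_pair_leq (e x) (e y) s' s'' x sz (fun i hi => H (Ordinal hi)).
  by rewrite -dx -dy; have := degC x xC; have := degC y yC; lia.
case/forallPn => i; rewrite negbK => /andP[exi eyi].
have i_s : i.+1 < size s by rewrite sz1 ltnS ltn_ord.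
have nthi : nth x s'' i = nth x s i.
  by rewrite def_s nth_rcons -sz ltn_ord.
(* Reversing the part after position [i] uses the edge from vertex [i] to [y]; the edge from vertex
   [i + 1] to [x] then closes the cycle. *)
pose s1 := take i.+1 s; pose s2 := drop i.+1 s.
have s12 : s = s1 ++ s2 by rewrite cat_take_drop.
have n1 : s1 != [::] by rewrite -size_eq0 size_takel // ltnW.
have n2 : rev s2 != [::] by rewrite -size_eq0 size_rev size_drop subn_eq0 -ltnNge.
have l1 : last x s1 = nth x s i.
  by rewrite -nth_last size_takel ?nth_take // ltnW.
have s2n : s2 = nth x s' i :: drop i.+2 s by rewrite /s2 (drop_nth x).
have h2 : head x (rev s2) = y.
  have -> : y = last x (s1 ++ s2) by rewrite -s12.
  by rewrite last_cat s2n (lastI _ (drop _ _)) rev_rcons last_rcons.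
have l2 : last x (rev s2) = nth x s' i by rewrite s2n rev_cons last_rcons.
have gr : gpath e (s1 ++ rev s2).
  rewrite (gpath_cat x) // gpath_take // gpath_rev gpath_drop // l1 h2 symE -nthi eyi andbT /=.
  by move: us; rewrite s12 cat_uniq => /and3P[_ h _]; rewrite has_rev.
have mr z : (z \in s1 ++ rev s2) = (z \in s) by rewrite s12 !mem_cat mem_rev.
have [r def_r] : exists r, s1 ++ rev s2 = x :: r by exists (take i s' ++ rev s2).
have cyc : cycle e (x :: r).
  rewrite /= rcons_path; case/andP: (gr); rewrite def_r => _ /= ->.
  have -> : last x r = last x (s1 ++ rev s2) by rewrite def_r.
  by rewrite last_cat; case: (rev s2) n2 l2 => //= c l _ ->; rewrite symE.
have [z /andP[zC zs]] : exists z, (z \in C) && (z \notin s).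
  apply/existsP; apply: contraLR cardC; rewrite negb_exists -leqNgt => /forallP H.
  apply: leq_trans les; rewrite -(card_uniqP us); apply: subset_leq_card.
  by apply/subsetP => z zC; have := H z; rewrite zC negbK.
have [u [v [us' vs euv]]] := @connect_leave (mem s) x z (conC _ _ xC zC) (mem_head _ _) zs.
have vC : v \in C by apply: clC euv; move/allP: sC; apply.
(* Cut open at [u], the cycle becomes a path that [v] prolongs. *)
have /rot_to[j w rotw] : u \in x :: r by rewrite -def_r mr.
have cw : cycle e (u :: w) by rewrite -rotw rot_cycle.
have uw : uniq (u :: w) by rewrite -rotw rot_uniq -def_r; case/andP: gr.
have mw t : (t \in u :: w) = (t \in s) by rewrite -rotw mem_rot -def_r mr.
have := maxs (v :: u :: w); rewrite /P gpath_cons2 mw vs /= symE euv /gpath uw /=.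
move: cw; rewrite /= rcons_path => /andP[-> _].
have -> : size w = size s'.
  by apply/eqP; rewrite -eqSS -[_.+1]/(size (u :: w)) -rotw size_rot -def_r size_cat size_rev -size_cat -s12.
have allw : all (mem C) (u :: w) by apply/allP => t; rewrite mw; move/allP: sC; apply.
by move: allw => /= ->; rewrite vC ltnn => /(_ isT).
Qed.

End Paths.

(** * Longest paths *)

Definition spread (i j : nat) := i + 2 <= j.

Lemma spread_nth t i j : sorted spread t -> i <= j < size t ->
  nth 0 t i + 2 * (j - i) <= nth 0 t j.
Proof.
move=> st /andP[]; elim: j => [|j IH] ij jt; first by case: i ij => //; lia.
move: ij; rewrite leq_eqVlt => /orP[/eqP ->|]; first by lia.
rewrite ltnS => ij; have := IH ij (ltnW jt).
have : spread (nth 0 t j) (nth 0 t j.+1) by apply: (sortedP 0 st).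
rewrite /spread; lia.
Qed.

Lemma spread_filter_iota (p : pred nat) n :
  (forall i, i.+1 < n -> p i -> p i.+1 -> False) ->
  sorted spread [seq i <- iota 0 n | p i].
Proof.
move=> H; set t := filter _ _.
have st : sorted ltn t by apply: sorted_filter; [exact: ltn_trans | exact: iota_ltn_sorted].
apply/(sortedP 0) => i it.
have := sortedP 0 st i it.
have mem_t j : j < size t -> p (nth 0 t j) /\ nth 0 t j < n.
  by move=> /(mem_nth 0); rewrite mem_filter mem_iota => /andP[].
have [p1 l1] := mem_t _ it; have [p2 _] := mem_t _ (ltnW it).
rewrite /= /spread addn2 leq_eqVlt => /orP[/eqP E|//].
by case: (H (nth 0 t i)); rewrite ?E.
Qed.

(** An interval of [2 * s + 1] integers holds [s + 1] elements with gaps at least 2 only as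
    [c, c + 2, ..., c + 2 * s]. Every [j] in the interval then has such an element at distance 1 or
    2. *)
Lemma spread_tight t c s j : sorted spread t -> 0 < s < size t ->
  (forall i, i \in t -> c <= i <= c + 2 * s) -> c <= j <= c + 2 * s ->
  exists2 i, i \in t & [&& i != j, i <= j + 2 & j <= i + 2].
Proof.
move=> st /andP[s0 ssz] bnd cj.
have bndn m : m < size t -> c <= nth 0 t m <= c + 2 * s.
  by move=> mt; apply: bnd; apply: mem_nth.
have tE m : m <= s -> nth 0 t m = c + 2 * m.
  move=> ms.
  have h0 : 0 <= m < size t by lia.
  have hs : m <= s < size t by lia.
  have := spread_nth st h0; have := spread_nth st hs.
  have := bndn _ ssz; have := bndn 0 (leq_ltn_trans (leq0n s) ssz); lia.
have [r rb] : exists r, 2 * r <= j - c <= 2 * r + 1.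
  by exists (j - c)./2; lia.
have in_t m : m <= s -> c + 2 * m \in t.
  by move=> ms; rewrite -tE //; apply: mem_nth; apply: leq_ltn_trans ssz.
(* If [j] is itself in the progression, the next or the previous term serves; [0 < s] guarantees a
   next term when [r = 0]. *)
have [E|NE] := eqVneq (c + 2 * r) j; last first.
  exists (c + 2 * r); first by apply: in_t; lia.
  by rewrite NE; lia.
case: (posnP r) => r0.
  exists (c + 2 * 1); first by apply: in_t; lia.
  by lia.
exists (c + 2 * r.-1); first by apply: in_t; lia.
by lia.
Qed.

(** Turns a threshold condition into a comparison of numbers, as needed for the jumps in [pattern];
    [find] gives [k] if the condition never holds. *)
Lemma find_iota_mono (p : pred nat) k j :
  (forall i i', i <= i' < k -> p i -> p i') -> j < k ->
  (find p (iota 0 k) <= j) = p j.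
Proof.
move=> mono jk; case: leqP => h; last first.
  by have := before_find 0 h; rewrite nth_iota // add0n => ->.
have hk : find p (iota 0 k) < k by lia.
have hs : has p (iota 0 k) by rewrite has_find size_iota.
have := nth_find 0 hs; rewrite nth_iota // add0n => pf.
by symmetry; apply: mono pf; rewrite h.
Qed.

(* The [j]-th element of a [k]-subset of [{1, ..., 2k+1}] without consecutive elements
   exceeds [2j + 1] by 0, 1 or 2, and this excess is nondecreasing in [j]; [p] and
   [p'] mark its jumps. *)
Definition pattern (p p' j : nat) := 2 * j + 1 + (p <= j) + (p' <= j).

Lemma pattern_inj p p' : injective (pattern p p').
Proof. by move=> i j; rewrite /pattern; lia. Qed.

Lemma spread_pattern t k : sorted spread t -> k <= size t ->
  (forall i, i \in t -> 1 <= i <= 2 * k + 1) ->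
  exists p p', [/\ p <= k, p' <= k & forall j, j < k -> pattern p p' j \in t].
Proof.
move=> st kt bnd.
have bndn m : m < size t -> 1 <= nth 0 t m <= 2 * k + 1.
  by move=> mt; apply: bnd; apply: mem_nth.
have lo j : j < k -> 2 * j + 1 <= nth 0 t j.
  move=> jk; have h : 0 <= j < size t by lia.
  have := spread_nth st h.
  have h0 : 0 < size t by lia.
  by have := bndn _ h0; lia.
(* Counted back from element [k - 1], which is at most [2 * k + 1]. *)
have hi j : j < k -> nth 0 t j <= 2 * j + 3.
  move=> jk; have h : j <= k.-1 < size t by lia.
  have := spread_nth st h.
  have h0 : k.-1 < size t by lia.
  by have := bndn _ h0; lia.
have mono d i i' : i <= i' < k -> 2 * i + d < nth 0 t i -> 2 * i' + d < nth 0 t i'.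
  move=> h; have h' : i <= i' < size t by lia.
  by have := spread_nth st h'; lia.
(* [f 1] and [f 2] are the first indices at which the excess over [2 * j + 1] reaches 1 and 2. *)
pose f d := find (fun j => 2 * j + d < nth 0 t j) (iota 0 k).
have fk d : f d <= k by rewrite -[k in _ <= k](size_iota 0 k) find_size.
exists (f 1), (f 2); split => // j jk.
suff -> : pattern (f 1) (f 2) j = nth 0 t j by apply/mem_nth/(leq_trans jk).
rewrite /pattern /f !find_iota_mono //; try exact: mono.
by move=> /=; have := lo _ jk; have := hi _ jk; lia.
Qed.

Lemma pigeonhole (T J : finType) (A : {set T}) (f : T -> J) m :
  #|J| * m < #|A| -> exists j, m < #|[set x in A | f x == j]|.
Proof.
move=> h; apply/existsP; apply: contraLR h; rewrite negb_exists -leqNgt => /forallP H.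
rewrite -sum1_card (partition_big f xpredT) //= -sum_nat_const.
apply: leq_sum => j _; have := H j; rewrite -leqNgt; apply: leq_trans.
by rewrite -sum1_card; apply: eq_leq; apply: eq_bigl => x; rewrite inE.
Qed.

(** * Detours from a longest path *)

Section LongestPath.
Variables (T : finType) (e : rel T).
Hypotheses (symE : symmetric e) (irrE : irreflexive e).
Variable Q : seq T.
Hypotheses (gQ : gpath e Q) (maxQ : forall s, gpath e s -> size s <= size Q).

(** Replacing the [j - i - 1] vertices of [Q] strictly between positions [i] and [j] by [P] gives a
    path, which cannot be longer than [Q]. *)
Lemma longest_insert x0 P i j : gpath e P -> P != [::] -> ~~ has (mem Q) P ->
  i < j < size Q -> e (nth x0 Q i) (head x0 P) -> e (last x0 P) (nth x0 Q j) ->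
  i + size P < j.
Proof.
move=> gP nP dP /andP[ij jQ] ei ej.
have sz1 : size (take i.+1 Q) = i.+1 by rewrite size_takel //; lia.
have n1 : take i.+1 Q != [::] by rewrite -size_eq0 sz1.
have n2 : drop j Q != [::] by rewrite -size_eq0 size_drop subn_eq0 -ltnNge.
have [d1 d2] : ~~ has (mem P) (drop j Q) /\ ~~ has (mem (take i.+1 Q)) P.
  split; apply/hasPn => z.
    by move/mem_drop => zQ; apply/negP => zP; case/negP: dP; apply/hasP; exists z.
  by move=> zP; apply/negP => /mem_take zQ; case/negP: dP; apply/hasP; exists z.
have d3 : ~~ has (mem (take i.+1 Q)) (drop j Q).
  have : uniq (take j Q ++ drop j Q) by rewrite cat_take_drop; case/andP: gQ.
  rewrite cat_uniq => /and3P[_ d _]; apply: contra d => /hasP[z z2 z1].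
  apply/hasP; exists z => //=.
  by move: z1; rewrite -[Q in take i.+1 Q](cat_take_drop j) takel_cat ?size_takel ?(ltnW jQ) // => /mem_take.
have n3 : P ++ drop j Q != [::] by case: (P) nP.
have hd : head x0 (P ++ drop j Q) = head x0 P by case: (P) nP.
have l1 : last x0 (take i.+1 Q) = nth x0 Q i.
  by rewrite -nth_last sz1 nth_take.
have h2 : head x0 (drop j Q) = nth x0 Q j by rewrite -nth0 nth_drop addn0.
have : gpath e (take i.+1 Q ++ P ++ drop j Q).
  rewrite (gpath_cat _ x0) // (gpath_cat _ x0) // gpath_take // gpath_drop // gP d1 h2 ej.
  by rewrite has_cat negb_or d2 d3 hd l1 ei.
by move/maxQ; rewrite !size_cat sz1 size_drop => h; clear -h ij jQ; lia.
Qed.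

(** Here [P] replaces the first [j] vertices of [Q]; in [longest_suffix] it replaces those after
    position [i]. *)
Lemma longest_prefix x0 P j : gpath e P -> P != [::] -> ~~ has (mem Q) P ->
  j < size Q -> e (last x0 P) (nth x0 Q j) -> size P <= j.
Proof.
move=> gP nP dP jQ ej.
have n2 : drop j Q != [::] by rewrite -size_eq0 size_drop subn_eq0 -ltnNge.
have h2 : head x0 (drop j Q) = nth x0 Q j by rewrite -nth0 nth_drop addn0.
have d1 : ~~ has (mem P) (drop j Q).
  by apply/hasPn => z /mem_drop zQ; apply/negP => zP; case/negP: dP; apply/hasP; exists z.
have : gpath e (P ++ drop j Q) by rewrite (gpath_cat _ x0) // gP gpath_drop // d1 h2.
by move/maxQ; rewrite size_cat size_drop; lia.
Qed.

Lemma longest_suffix x0 P i : gpath e P -> P != [::] -> ~~ has (mem Q) P ->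
  i < size Q -> e (nth x0 Q i) (head x0 P) -> i + size P < size Q.
Proof.
move=> gP nP dP iQ ei.
have sz1 : size (take i.+1 Q) = i.+1 by rewrite size_takel //; lia.
have n1 : take i.+1 Q != [::] by rewrite -size_eq0 sz1.
have l1 : last x0 (take i.+1 Q) = nth x0 Q i.
  by rewrite -nth_last sz1 nth_take.
have d1 : ~~ has (mem (take i.+1 Q)) P.
  by apply/hasPn => z zP; apply/negP => /mem_take zQ; case/negP: dP; apply/hasP; exists z.
have : gpath e (take i.+1 Q ++ P) by rewrite (gpath_cat _ x0) // gP gpath_take // d1 l1.
by move/maxQ; rewrite size_cat sz1; lia.
Qed.

Definition nbr_pos x := [seq i <- iota 0 (size Q) | e x (nth x Q i)].

Lemma mem_nbr_pos x0 x i : (i \in nbr_pos x) = (i < size Q) && e x (nth x0 Q i).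
Proof.
rewrite mem_filter mem_iota /= add0n andbC; case: ltnP => //= iQ.
by rewrite (set_nth_default x0).
Qed.

Lemma size_nbr_pos x : size (nbr_pos x) = count (e x) Q.
Proof.
by rewrite size_filter -[in RHS](mkseq_nth x Q) /mkseq count_map; apply: eq_count.
Qed.

(** A vertex adjacent to two consecutive vertices of [Q] could be inserted between them. *)
Lemma nbr_pos_spread x : x \notin Q -> sorted spread (nbr_pos x).
Proof.
move=> xQ; apply: spread_filter_iota => i iQ e1 e2.
have := @longest_insert x [:: x] i i.+1.
by rewrite /= orbF xQ symE e1 e2 ltnS leqnn iQ addn1 ltnn => /(_ isT isT isT isT isT isT).
Qed.

End LongestPath.

(** An end of a path misses itself among the vertices of the path, and misses the other end as well
    if the two are not adjacent. *)
Lemma count_nbrs_first (T : finType) (e : rel T) x y P : irreflexive e ->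
  count (e x) (x :: rcons P y) + 1 + ~~ e x y <= size P + 2.
Proof.
move=> irrE; rewrite /= irrE -cats1 count_cat /= addn0.
by have := count_size (e x) P; case: (e x y) => /=; lia.
Qed.

(** * Vertices off a longest path *)

Section OutsideLongestPath.
Variables (T : finType) (e : rel T) (k : nat).
Hypotheses (symE : symmetric e) (irrE : irreflexive e).
Hypothesis degE : forall x, k <= deg e x.
Hypothesis deg2E : forall x y, e x y -> 2 * k < deg e x + deg e y.
Variable Q : seq T.
Hypotheses (gQ : gpath e Q) (maxQ : forall s, gpath e s -> size s <= size Q).
Hypothesis sizeQ : size Q <= 2 * k + 3.
Let t := nbr_pos e Q.

(* The neighbours of [x] fill every second position of their range, and those of [y]
   must keep distance at least 3 from them. *)
Lemma ends_of_outside_path x y P : gpath e (x :: rcons P y) ->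
  ~~ has (mem Q) (x :: rcons P y) -> size P + 2 <= k ->
  k < size (t x) + size P + 1 -> 0 < size (t y) -> False.
Proof.
set R := x :: rcons P y => gR dR Pk tx ty.
have nR : R != [::] by [].
have szR : size R = size P + 2 by rewrite /= size_rcons addn2.
have lR : last x R = y by rewrite /R /= last_rcons.
have gR' : gpath e (rev R) by rewrite gpath_rev.
have nR' : rev R != [::] by rewrite -size_eq0 size_rev.
have dR' : ~~ has (mem Q) (rev R) by rewrite has_rev.
have hR' : head x (rev R) = y by rewrite /R rev_cons rev_rcons.
have lR' : last x (rev R) = x by rewrite rev_cons last_rcons.
have xQ : x \notin Q by apply: contra dR => xQ; rewrite /R /= xQ.
(* A neighbour of either end of [R] keeps [size R] positions of [Q] free on both sides, since
   otherwise [R] could replace the shorter side. *)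
have bx i : i \in t x -> size P + 2 <= i /\ i + size P + 2 < size Q.
  rewrite (mem_nbr_pos _ _ x) => /andP[iQ exi].
  have := longest_prefix gQ maxQ gR' nR' dR' iQ (x0 := x).
  have := longest_suffix gQ maxQ gR nR dR iQ (x0 := x).
  rewrite lR' -[head x R]/x symE exi size_rev szR => /(_ isT) h1 /(_ isT) h2.
  by split => //; rewrite -addnA.
have b_y i : i \in t y -> size P + 2 <= i /\ i + size P + 2 < size Q.
  rewrite (mem_nbr_pos _ _ x) => /andP[iQ eyi].
  have := longest_prefix gQ maxQ gR nR dR iQ (x0 := x).
  have := longest_suffix gQ maxQ gR' nR' dR' iQ (x0 := x).
  rewrite lR hR' symE eyi size_rev szR => /(_ isT) h1 /(_ isT) h2.
  by split => //; rewrite -addnA.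
case def_ty : (t y) ty => [|j ty'] // _.
have jt : j \in t y by rewrite def_ty mem_head.
have [j1 j2] := b_y _ jt.
(* As [size Q <= 2 * k + 3], the positions allowed run from [size P + 2] to [2 * k - size P], which
   is [c + 2 * s] for this choice of [c] and [s]. *)
have := @spread_tight (t x) (size P + 2) (k - (size P + 1)) j.
case.
- exact: nbr_pos_spread.
- by clear -Pk tx; lia.
- by move=> i /bx[i1 i2]; clear -i1 i2 Pk tx sizeQ; lia.
- by clear -j1 j2 Pk sizeQ; lia.
move=> i it /and3P[/eqP ij i1 i2].
move: (it) (jt); rewrite !(mem_nbr_pos _ _ x) => /andP[iQ exi] /andP[jQ eyj].
(* Rerouting [Q] through all of [R] between [i] and [j] requires a distance above [size R >= 2], but
   the distance is at most 2. *)
case: (ltngtP i j) => // lt.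
- have := longest_insert gQ maxQ gR nR dR (x0 := x) (i := i) (j := j).
  rewrite lt jQ lR eyj /= symE exi size_rcons => /(_ isT isT isT) h; clear -h i1 i2; lia.
have := longest_insert gQ maxQ gR' nR' dR' (x0 := x) (i := j) (j := i).
rewrite lt iQ lR' exi hR' symE eyj size_rev szR => /(_ isT isT isT) h; clear -h i1 i2; lia.
Qed.

(** By maximality, the ends of a longest path [R] off [Q] have all their neighbours on [R] or [Q].
    At most [size R - 1] of them lie on [R], so the degree bounds leave both ends a neighbour on [Q]
    and one of them enough for [ends_of_outside_path]. *)
Lemma outside_edgeless :
  (forall P, gpath e P -> ~~ has (mem Q) P -> size P <= k) ->
  forall x y, x \notin Q -> y \notin Q -> ~~ e x y.
Proof.
move=> shortP x0 y0 x0Q y0Q; apply/negP => e0.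
pose Pr s := gpath e s && ~~ has (mem Q) s.
have Pr0 : Pr [:: x0; y0].
  rewrite /Pr gpath_cons2 e0 /= !inE (negbTE x0Q) (negbTE y0Q) !andbT.
  by apply: contraTneq e0 => ->; rewrite irrE.
have [] := @longest_exists T Pr k.
- by exists [:: x0; y0].
- by move=> s /andP[]; apply: shortP.
move=> R [/andP[gR dR] maxR].
have szR : 2 <= size R by apply: (maxR _ Pr0).
have szk : size R <= k by apply: shortP.
case: R => [|x R'] // in gR dR maxR szR szk.
case/lastP: R' => [|P y] // in gR dR maxR szR szk.
set R := x :: rcons P y in gR dR maxR szR szk.
have sR : size R = size P + 2 by rewrite /= size_rcons addn2.
have nbr u S : size S = size R -> Pr S -> head x S = u -> forall z, e u z -> z \in S ++ Q.
  move=> szS PrS hS z euz; rewrite mem_cat; apply/negPn/negP; rewrite negb_or => /andP[zS zQ].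
  have : Pr (z :: S).
    case: S => [|u' S] //= in szS PrS hS zS *.
    rewrite -hS in euz; case/andP: PrS => gS dS.
    by rewrite /Pr gpath_cons2 zS symE euz gS /= negb_or zQ.
  by move/maxR; rewrite /= szS ltnn.
have PrR : Pr R by rewrite /Pr gR.
have PrR' : Pr (rev R) by rewrite /Pr gpath_rev // gR has_rev.
have uRQ : uniq (R ++ Q).
  case/andP: gR => uR _; case/andP: gQ => uQ _; rewrite cat_uniq uR uQ andbT /=.
  apply/hasPn => z zQ; apply/negP => zR; case/negP: dR; apply/hasP; by exists z.
have dx : deg e x = count (e x) R + count (e x) Q.
  by rewrite -count_cat; apply: deg_count => // z; apply: (@nbr x R).
have dy : deg e y = count (e y) R + count (e y) Q.
  rewrite -count_cat; apply: deg_count => // z eyz.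
  have hR' : head x (rev R) = y by rewrite /R rev_cons rev_rcons.
  by have := @nbr y (rev R) (size_rev R) PrR' hR' z eyz; rewrite !mem_cat mem_rev.
have cx : count (e x) R + 1 + ~~ e x y <= size R.
  by rewrite sR; apply: count_nbrs_first.
have cy : count (e y) R + 1 + ~~ e x y <= size R.
  have := count_nbrs_first y x (rev P) irrE.
  by rewrite -rev_cons -rev_rcons count_rev size_rev symE sR.
have tx : size (t x) = count (e x) Q by apply: size_nbr_pos.
have ty : size (t y) = count (e y) Q by apply: size_nbr_pos.
have d1 := degE x; have d2 := degE y.
(* Adjacent and non-adjacent ends are treated together: non-adjacent ones lack the degree-sum bound
   but each has one neighbour fewer on [R]. *)
have d3 : 2 * k < deg e x + deg e y + ~~ e x y + ~~ e x y.
  case: (boolP (e x y)) => [/deg2E|nxy]; first by rewrite !addn0.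
  by clear -d1 d2; lia.
case: (ltnP k (size (t x) + size P + 1)) => h.
  apply: (ends_of_outside_path gR dR) => //; first by rewrite -sR.
  by clear -dx dy cx cy tx ty d1 d2 d3 szk sR; lia.
have gR' : gpath e (y :: rcons (rev P) x).
  by rewrite -rev_cons -rev_rcons gpath_rev.
have dR' : ~~ has (mem Q) (y :: rcons (rev P) x).
  by rewrite -rev_cons -rev_rcons has_rev.
apply: (ends_of_outside_path gR' dR'); rewrite ?size_rev; first by rewrite -sR.
  by clear -dx dy cx cy tx ty d1 d2 d3 h szk sR; lia.
by clear -dx dy cx cy tx ty d1 d2 d3 h szk sR; lia.
Qed.

(** All neighbours of a vertex off [Q] lie on [Q], at positions containing one of [(k + 1) ^ 2]
    patterns. At least [#|T| - (2 * k + 3)] vertices are off [Q], so one pattern is shared by more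
    than [m] of them; its positions give [U]. *)
Lemma common_neighbourhood m :
  (forall x y, x \notin Q -> y \notin Q -> ~~ e x y) ->
  2 * k + 3 + k.+1 * k.+1 * m < #|T| ->
  exists U W : {set T},
    [/\ #|U| = k, m < #|W| & forall u w, u \in U -> w \in W -> e u w].
Proof.
move=> indep big.
have /card_gt0P[x0 _] : 0 < #|T| by lia.
have uQ : uniq Q by case/andP: gQ.
pose good (pp : 'I_k.+1 * 'I_k.+1) x :=
  [forall j : 'I_k, (pattern pp.1 pp.2 j < size Q) && e x (nth x0 Q (pattern pp.1 pp.2 j))].
have ex_good x : x \notin Q -> exists pp, good pp x.
  move=> xQ.
  have dx : deg e x = size (t x).
    rewrite size_nbr_pos; apply: deg_count => // z exz.
    by apply/negPn/negP => zQ; have := indep _ _ xQ zQ; rewrite exz.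
  have gx : gpath e [:: x] by [].
  have dQ : ~~ has (mem Q) [:: x] by rewrite /= orbF.
  have [| |i it|p [p' [pk p'k H]]] := @spread_pattern (t x) k.
  - exact: nbr_pos_spread.
  - by rewrite -dx.
  - move: it; rewrite (mem_nbr_pos _ _ x) => /andP[iQ exi].
    have := longest_prefix gQ maxQ gx isT dQ iQ (x0 := x).
    have := longest_suffix gQ maxQ gx isT dQ iQ (x0 := x).
    by rewrite /= symE exi => /(_ isT) h1 /(_ isT) h2; lia.
  exists (Ordinal (pk : p < k.+1), Ordinal (p'k : p' < k.+1)).
  by apply/forallP => j; rewrite -mem_nbr_pos; apply: H.
(* The default is never taken for a vertex off [Q]. *)
pose f x := odflt (ord0, ord0) [pick pp | good pp x].
have fP x : x \notin Q -> good (f x) x.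
  by move=> /ex_good[pp gpp]; rewrite /f; case: pickP => //= /(_ pp); rewrite gpp.
have [|pp ppm] := @pigeonhole T _ (~: [set x in Q]) f m.
  rewrite card_prod !card_ord.
  have := cardsC [set x in Q]; rewrite cardsE (card_uniqP uQ); lia.
set W := [set x in _ | _] in ppm.
have WP x : x \in W -> good pp x.
  by rewrite !inE => /andP[xQ /eqP <-]; apply: fP.
have [w0 w0W] : exists w, w \in W by apply/card_gt0P; lia.
exists [set nth x0 Q (pattern pp.1 pp.2 j) | j : 'I_k], W; split => //.
  rewrite card_imset ?card_ord // => i j /eqP.
  have /forallP H := WP _ w0W.
  have /andP[hi _] := H i; have /andP[hj _] := H j.
  by rewrite nth_uniq // => /eqP /pattern_inj /val_inj.
move=> u w /imsetP[j _ ->] /WP /forallP /(_ j) /andP[_].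
by rewrite symE.
Qed.

End OutsideLongestPath.

(** * Paths through a set with many common neighbours *)

Fixpoint zigzag (T : Type) (us ws : seq T) : seq T :=
  match us, ws with
  | u :: us', w :: ws' => [:: u, w & zigzag us' ws']
  | _, _ => [::]
  end.

Lemma perm_zigzag (T : eqType) (us ws : seq T) : size us = size ws ->
  perm_eq (zigzag us ws) (us ++ ws).
Proof.
elim: us ws => [|u us IH] [|w ws] //= [/IH/permP h].
by apply/permP => z /=; rewrite h !count_cat /=; lia.
Qed.

Lemma last_zigzag (T : Type) (x : T) us ws : size us = size ws ->
  last x (zigzag us ws) = last x ws.
Proof. by elim: us ws x => [|u us IH] [|w ws] x //= [/IH]. Qed.

Section Zigzag.
Variables (T : finType) (e : rel T) (U W : {set T}).
Hypotheses (symE : symmetric e) (irrE : irreflexive e).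

Definition joined (x : T) := [forall (u | u \in U), e u x].

Lemma joinedP x : reflect (forall u, u \in U -> e u x) (joined x).
Proof. exact: (iffP forall_inP). Qed.

Lemma joined_notin x : joined x -> x \notin U.
Proof. by move=> /joinedP h; apply/negP => /h; rewrite irrE. Qed.

Lemma path_zigzag x us ws : size us = size ws ->
  all (mem U) us -> all joined ws -> (us != [::] -> e x (head x us)) ->
  path e x (zigzag us ws).
Proof.
elim: us ws x => [|u us IH] [|w ws] x //= [sz] /andP[uU usU] /andP[jw jws] /(_ isT) ->.
rewrite (joinedP _ jw) //=; apply: IH => //.
case: us usU {sz} => //= u' us /andP[u'U _] _.
by rewrite symE (joinedP _ jw).
Qed.

Lemma gpath_zigzag x0 pre us ws post :
  uniq (pre ++ (us ++ ws) ++ post) -> size us = size ws -> pre != [::] ->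
  sorted e pre -> sorted e post -> all (mem U) us -> all joined ws ->
  (us != [::] -> e (last x0 pre) (head x0 us)) ->
  (post != [::] -> ws != [::] /\ e (last x0 ws) (head x0 post)) ->
  gpath e (pre ++ zigzag us ws ++ post).
Proof.
move=> uall sz npre spre spost usU jws e1 e2.
have pm : perm_eq (pre ++ zigzag us ws ++ post) (pre ++ (us ++ ws) ++ post).
  by rewrite perm_cat2l perm_cat2r perm_zigzag.
rewrite /gpath (perm_uniq pm) uall /=.
case: pre npre spre e1 {uall pm} => //= x pre _ spre e1.
rewrite !cat_path spre /= last_zigzag //; apply/andP; split.
  by apply: path_zigzag => //; case: (us) e1.
case: post spost e2 => //= z post spost /(_ isT)[nws ez].
by rewrite spost andbT; case: (ws) nws ez.
Qed.

Hypothesis joinW : forall w, w \in W -> joined w.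

(* The first path is [pre], a zigzag between [U] and [W] whose last vertices outside
   [U] are those of [c], then [post]; the second one zigzags between [U] and [W]. *)
Lemma zigzag_paths pre c post u t t' x0 :
  uniq (pre ++ c ++ post) -> ~~ has (mem U) (pre ++ c ++ post) ->
  pre != [::] -> sorted e pre -> sorted e post ->
  u \in U -> e (last x0 pre) u -> all joined c ->
  (post != [::] -> c != [::] /\ e (last x0 c) (head x0 post)) ->
  size c <= t -> t + t' <= #|U| -> t + t' + 1 + size (pre ++ c ++ post) <= #|W| ->
  exists p q, [/\ gpath e p, gpath e q, ~~ has (mem p) q,
    size p = size pre + 2 * t + size post & size q = 2 * t' + 1].
Proof.
move=> uF dF npre spre spost uU eu jc epost ct tU tW.
(* Listing [u] first makes the zigzag start at the vertex of [U] adjacent to the end of [pre]. *)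
pose us := u :: enum (U :\ u).
have szus : size us = #|U| by rewrite /us /= -cardE (cardsD1 u U) uU.
have uus : uniq us by rewrite /= enum_uniq andbT mem_enum !inE eqxx.
have usU z : z \in us -> z \in U.
  by rewrite inE mem_enum !inE => /orP[/eqP ->|/andP[]].
pose F := pre ++ c ++ post.
pose ws := enum (W :\: [set z in F]).
have szws : t + t' + 1 <= size ws.
  rewrite -cardE cardsD.
  have : #|W :&: [set z in F]| <= size F.
    apply: leq_trans (card_size F); apply: subset_leq_card.
    by apply/subsetP => z; rewrite !inE => /andP[].
  by clear -tW; rewrite -/F in tW *; lia.
have uws : uniq ws by apply: enum_uniq.
have wsP z : z \in ws -> joined z /\ z \notin F.
  by rewrite mem_enum !inE => /andP[zF zW]; split => //; apply: joinW.
(* The first zigzag takes [t] vertices of [U] and, since [c] supplies its last ones, only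
   [t - size c] fresh vertices of [W]. The second path starts in [W] and needs [t' + 1] of them. *)
pose us1 := take t us; pose us2 := take t' (drop t us).
pose ws1 := take (t - size c) ws.
pose ws2 := drop (t - size c) ws.
have sz1 : size us1 = t by rewrite size_takel // szus; apply: leq_trans tU; apply: leq_addr.
have sz2 : size us2 = t'.
  by rewrite size_takel // size_drop szus; clear -tU; lia.
have sz3 : size ws1 = t - size c.
  by rewrite size_takel //; clear -szws; lia.
have sz4 : t' < size ws2 by rewrite size_drop; clear -szws; lia.
case def2 : ws2 => [|w0 ws2']; first by rewrite def2 in sz4.
pose ws3 := take t' ws2'.
have sz5 : size ws3 = t' by rewrite size_takel //; move: sz4; rewrite def2.
pose p := pre ++ zigzag us1 (ws1 ++ c) ++ post.
pose q := [:: w0] ++ zigzag us2 ws3 ++ [::].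
have szc : size us1 = size (ws1 ++ c) by rewrite size_cat sz1 sz3 subnK.
have szd : size us2 = size ws3 by rewrite sz2 sz5.
have pp : perm_eq p (F ++ (us1 ++ ws1)).
  rewrite /p /F; apply: (@perm_trans _ (pre ++ (us1 ++ ws1 ++ c) ++ post)).
    by rewrite perm_cat2l perm_cat2r perm_zigzag.
  by apply/permP => z; rewrite !count_cat; clear; lia.
have pq : perm_eq q (us2 ++ w0 :: ws3).
  rewrite /q cats0; apply: (@perm_trans _ ([:: w0] ++ us2 ++ ws3)).
    by rewrite perm_cat2l perm_zigzag.
  by rewrite perm_catCA.
have sub1 z : z \in us1 -> z \in us by apply: mem_take.
have sub2 z : z \in us2 -> z \in us by move/mem_take/mem_drop.
have sub3 z : z \in ws1 -> z \in ws by apply: mem_take.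
have sub4 z : z \in w0 :: ws3 -> z \in ws.
  move=> h; apply: (@mem_drop (t - size c)); rewrite -/ws2 def2.
  by move: h; rewrite !inE => /orP[->//|/mem_take ->]; rewrite orbT.
have disU z : z \in us -> z \notin ws.
  by move=> /usU zU; apply/negP => /wsP[/joined_notin]; rewrite zU.
have uus12 : uniq (us1 ++ us2).
  have : uniq (us1 ++ drop t us) by rewrite cat_take_drop.
  rewrite !cat_uniq => /and3P[-> h1 h2]; rewrite take_uniq // andbT /=.
  by apply: contra h1 => /hasP[z /mem_take z1 z2]; apply/hasP; exists z.
have uws12 : uniq (ws1 ++ w0 :: ws3).
  have : uniq (ws1 ++ ws2) by rewrite cat_take_drop.
  rewrite !cat_uniq def2 => /and3P[-> h1 /= /andP[h2 h3]].
  rewrite take_uniq // andbT; apply/andP; split.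
    apply: contra h1 => /orP[h|/hasP[z /mem_take z1 z2]]; apply/orP; first by left.
    by right; apply/hasP; exists z.
  by apply: contra h2 => /mem_take.
have uall : uniq ((F ++ (us1 ++ us2)) ++ (ws1 ++ w0 :: ws3)).
  rewrite cat_uniq uws12 andbT cat_uniq uus12 andbT uF /=.
  apply/andP; split; apply/hasPn => z.
    rewrite mem_cat => /orP[/sub1|/sub2] /usU zU; apply/negP => zF;
    by case/negP: dF; apply/hasP; exists z.
  rewrite mem_cat => h.
  have zws : z \in ws by case/orP: h => [/sub3|/sub4].
  rewrite /= mem_cat negb_or; have [_ ->] := wsP _ zws.
  apply/negP; rewrite mem_cat => /orP[/sub1|/sub2] /disU; by rewrite zws.
have upq : uniq (p ++ q).
  rewrite (perm_uniq (perm_cat pp pq)); move: uall; rewrite (@perm_uniq _ _ ((F ++ us1 ++ ws1) ++ us2 ++ w0 :: ws3)) //.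
  by apply/permP => z; rewrite !count_cat; clear; lia.
move: (upq); rewrite cat_uniq => /and3P[up dpq uq].
exists p, q; split => //.
- apply: (@gpath_zigzag x0) => //.
  + rewrite -(perm_uniq (s1 := p)) //; apply: (perm_trans pp).
    by rewrite /F; apply/permP => z; rewrite !count_cat; clear; lia.
  + by apply/allP => z /sub1 /usU.
  + rewrite all_cat jc andbT; apply/allP => z /sub3 /wsP[] //.
  + by rewrite /us1 /us; case: (t).
  + by move=> /epost[nc ec]; rewrite last_cat; case: (c) nc ec => [|c0 c'] //= _ ->; split => //; case: (ws1).
- apply: (@gpath_zigzag x0) => //.
  + by rewrite -(perm_uniq (s1 := q)) // /q !cats0 perm_cat2l perm_zigzag.
  + by apply/allP => z /sub2 /usU.
  + by apply/allP => z zw; have [] := wsP z (sub4 z _) => //; rewrite inE zw orbT.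
  + case def_us2 : us2 => [|u2 r] // _ /=.
    have u2U : u2 \in U by apply/usU/sub2; rewrite def_us2 mem_head.
    have [/joinedP jw0 _] := wsP w0 (sub4 w0 (mem_head _ _)).
    by rewrite symE jw0.
- by rewrite (perm_size pp) !size_cat sz1 sz3; clear -ct; lia.
by rewrite (perm_size pq) size_cat /= sz2 sz5; clear; lia.
Qed.

End Zigzag.

(** * Edges avoiding [U] *)

Section OutsideU.
Variables (T : finType) (e : rel T) (a b k : nat) (U W : {set T}).
Hypotheses (symE : symmetric e) (irrE : irreflexive e).
Hypotheses (b2 : 2 <= b) (ba : b < a) (kE : k = (a./2 + b./2).-1).
Hypotheses (cardU : #|U| = k) (cardW : k + 5 <= #|W|).
Hypothesis joinW : forall w, w \in W -> joined e U w.
Hypothesis freeE : PaPb_free e a b.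

(** Starting with [y, x], a path on [2 * m] vertices uses only [m - 1] vertices of [U]. Applied to
    an even one of [a], [b], this saves one vertex, so the [k] vertices of [U] suffice for both
    paths. *)
Lemma attached_edge x y u : ~~ (odd a && odd b) ->
  x \notin U -> y \notin U -> e x y -> u \in U -> e x u -> False.
Proof.
move=> nodd xU yU exy uU exu; apply: freeE.
have uyx : uniq ([:: y; x] ++ [::] ++ [::]).
  by rewrite /= inE andbT; apply: contraTneq exy => ->; rewrite irrE.
have dyx : ~~ has (mem U) ([:: y; x] ++ [::] ++ [::]).
  by rewrite /= (negbTE xU) (negbTE yU).
have syx : sorted e [:: y; x] by rewrite /= symE exy.
have Ha := odd_double_half a; have Hb := odd_double_half b.
have [oa|oa] := boolP (odd a); last first.
  have [] := @zigzag_paths T e U W symE irrE joinW [:: y; x] [::] [::] u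
               a./2.-1 b./2 x uyx dyx isT syx isT uU exu isT => //.
  - by rewrite cardU; clear -kE oa Ha Hb b2 ba; lia.
  - by clear -cardW kE oa Ha Hb b2 ba => /=; lia.
  move=> p [q [gp gq dpq sp sq]].
  apply: (contains_of_paths _ gp gq dpq); rewrite ?sp ?sq /=;
    by clear -oa Ha Hb b2 ba; lia.
have ob : ~~ odd b by rewrite oa in nodd.
have [] := @zigzag_paths T e U W symE irrE joinW [:: y; x] [::] [::] u
             b./2.-1 a./2 x uyx dyx isT syx isT uU exu isT => //.
- by rewrite cardU; clear -kE ob Ha Hb b2 ba; lia.
- by clear -cardW kE ob Ha Hb b2 ba => /=; lia.
move=> p [q [gp gq dpq sp sq]].
rewrite has_sym in dpq.
by apply: (contains_of_paths _ gq gp dpq); rewrite ?sp ?sq /=;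
   clear -oa ob Ha Hb b2 ba; lia.
Qed.

(** The three vertices [z, y, x] followed by a zigzag through [a./2 - 1] vertices of [U] make a path
    on [a] vertices, leaving [b./2] vertices of [U] for the other path. *)
Lemma attached_path3 x y z u : odd a -> odd b ->
  x \notin U -> y \notin U -> z \notin U -> e x y -> e y z -> x != z ->
  u \in U -> e x u -> False.
Proof.
move=> oa ob xU yU zU exy eyz xz uU exu; apply: freeE.
have uF : uniq ([:: z; y; x] ++ [::] ++ [::]).
  rewrite /= !inE negb_or andbT (eq_sym z x) xz andbT; apply/andP; split.
    by apply: contraTneq eyz => ->; rewrite irrE.
  by apply: contraTneq exy => ->; rewrite irrE.
have dF : ~~ has (mem U) ([:: z; y; x] ++ [::] ++ [::]).
  by rewrite /= (negbTE xU) (negbTE yU) (negbTE zU).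
have sF : sorted e [:: z; y; x] by rewrite /= symE eyz symE exy.
have Ha := odd_double_half a; have Hb := odd_double_half b.
have [] := @zigzag_paths T e U W symE irrE joinW [:: z; y; x] [::] [::] u
             a./2.-1 b./2 x uF dF isT sF isT uU exu isT => //.
- by rewrite cardU; clear -kE oa ob Ha Hb b2 ba; lia.
- by clear -cardW kE oa ob Ha Hb b2 ba => /=; lia.
move=> p [q [gp gq dpq sp sq]].
by apply: (contains_of_paths _ gp gq dpq); rewrite ?sp ?sq /=;
   clear -oa ob Ha Hb b2 ba; lia.
Qed.

(** The path on [a] vertices starts with [y', x'], zigzags through [a./2 - 1] vertices of [U] and
    ends with [x, y]. *)
Lemma joined_edges x y x' y' : odd a -> odd b -> uniq [:: y'; x'; x; y] ->
  y \notin U -> y' \notin U -> e x y -> e x' y' ->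
  joined e U x -> joined e U x' -> False.
Proof.
move=> oa ob uF yU y'U exy exy' jx jx'; apply: freeE.
have xU := joined_notin irrE jx; have x'U := joined_notin irrE jx'.
have dF : ~~ has (mem U) ([:: y'; x'] ++ [:: x] ++ [:: y]).
  by rewrite /= (negbTE xU) (negbTE yU) (negbTE x'U) (negbTE y'U).
have sF : sorted e [:: y'; x'] by rewrite /= symE exy'.
have Ha := odd_double_half a; have Hb := odd_double_half b.
have [u uU] : exists u, u \in U.
  by apply/card_gt0P; rewrite cardU; clear -kE oa ob Ha Hb b2 ba; lia.
have exu : e x' u by rewrite symE (joinedP _ _ _ jx').
have jc : all (joined e U) [:: x] by rewrite /= jx.
have [] := @zigzag_paths T e U W symE irrE joinW [:: y'; x'] [:: x] [:: y] u
             a./2.-1 b./2 x uF dF isT sF isT uU exu jc => //.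
- by clear -oa ob Ha Hb b2 ba => /=; lia.
- by rewrite cardU; clear -kE oa ob Ha Hb b2 ba; lia.
- by clear -cardW kE oa ob Ha Hb b2 ba => /=; lia.
move=> p [q [gp gq dpq sp sq]].
by apply: (contains_of_paths _ gp gq dpq); rewrite ?sp ?sq /=;
   clear -oa ob Ha Hb b2 ba; lia.
Qed.

Hypothesis degE : forall x, k <= deg e x.
Hypothesis deg2E : forall x y, e x y -> 2 * k < deg e x + deg e y.
Hypothesis conE : forall x y, connect e x y.

Lemma core_nonempty : exists u, u \in U.
Proof.
have Ha := odd_double_half a; have Hb := odd_double_half b.
by apply/card_gt0P; rewrite cardU; clear -kE Ha Hb b2 ba; lia.
Qed.

(** By connectivity some edge leaves the set [B] of vertices lying on edges that avoid [U]. Its far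
    end must be in [U], so [attached_edge] applies. *)
Lemma outside_edgeless_even : ~~ (odd a && odd b) ->
  forall x y, x \notin U -> y \notin U -> ~~ e x y.
Proof.
move=> nodd x y xU yU; apply/negP => exy.
have [u uU] := core_nonempty.
pose B := [set z | (z \notin U) && [exists z', (z' \notin U) && e z z']].
have BP z z' : z \notin U -> z' \notin U -> e z z' -> z \in B.
  by move=> h h' ezz; rewrite inE h; apply/existsP; exists z'; rewrite h'.
have uB : u \notin B by rewrite inE uU.
have [v [w [vB wB evw]]] := connect_leave (conE x u) (BP x y xU yU exy) uB.
move: vB; rewrite inE => /andP[vU /existsP[v' /andP[v'U evv]]].
have [wU|wU] := boolP (w \in U); first exact: (attached_edge nodd vU v'U evv wU evw).
by case/negP: wB; apply: (BP w v) => //; rewrite symE.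
Qed.

(** Let [B] consist of the ends of edges avoiding [U] that have no neighbour in [U]. An edge from
    [v] in [B] to [w] outside [B] has [w] attached to [U]; as [v] has degree at least [k >= 2], a
    second neighbour [z] gives the forbidden path [z, v, w]. *)
Lemma edges_outside_attached x y : odd a -> odd b ->
  x \notin U -> y \notin U -> e x y -> exists2 u, u \in U & e x u.
Proof.
move=> oa ob xU yU exy.
have [/exists_inP//|natt] := boolP [exists u in U, e x u]; exfalso.
have [u uU] := core_nonempty.
have k2 : 1 < k.
  have Ha := odd_double_half a; have Hb := odd_double_half b.
  by clear -kE oa ob Ha Hb b2 ba; lia.
pose B := [set z | [&& z \notin U, ~~ [exists u in U, e z u] &
                       [exists z', (z' \notin U) && e z z']]].
have xB : x \in B.
  by rewrite inE xU natt; apply/existsP; exists y; rewrite yU.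
have uB : u \notin B by rewrite inE uU.
have [v [w [vB wB evw]]] := connect_leave (conE x u) xB uB.
move: vB; rewrite inE => /and3P[vU vatt _].
have wU : w \notin U.
  by apply: contra vatt => wU; apply/existsP; exists w; rewrite wU.
move: wB; rewrite inE wU /= negb_and negbK.
have -> : [exists z', (z' \notin U) && e w z'].
  by apply/existsP; exists v; rewrite vU symE.
rewrite orbF => /exists_inP[u' u'U ewu'].
have : deg e v <= #|[set w]|.
  apply: subset_leq_card; apply/subsetP => z; rewrite !inE => evz.
  have zU : z \notin U.
    by apply: contra vatt => zU; apply/existsP; exists z; rewrite zU.
  apply/negPn/negP => zw.
  by apply: (@attached_path3 w v z u') => //; rewrite 1?symE // eq_sym.
by rewrite cards1; have := degE v; clear -k2; lia.
Qed.

Lemma outside_nbr_unique x y z : odd a -> odd b ->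
  x \notin U -> y \notin U -> z \notin U -> e x y -> e x z -> z = y.
Proof.
move=> oa ob xU yU zU exy exz; apply/eqP/negPn/negP => zy.
have eyx : e y x by rewrite symE.
have [u uU eyu] := edges_outside_attached oa ob yU xU eyx.
by apply: (@attached_path3 y x z u) => //; rewrite eq_sym.
Qed.

(** Some end has degree above [k]; having only one neighbour outside [U], it is adjacent to all [k]
    vertices of [U]. *)
Lemma outside_edge_joined x y : odd a -> odd b ->
  x \notin U -> y \notin U -> e x y -> joined e U x \/ joined e U y.
Proof.
move=> oa ob xU yU exy.
have key v w : v \notin U -> w \notin U -> e v w -> k < deg e v -> joined e U v.
  move=> vU wU evw kd.
  have sub : [set z | e v z] \subset w |: (U :&: [set z | e v z]).
    apply/subsetP => z; rewrite !inE => evz; rewrite evz andbT.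
    have [zU|zU] := boolP (z \in U); first by rewrite orbT.
    by rewrite (outside_nbr_unique oa ob vU wU zU evw evz) eqxx.
  have c1 := subset_leq_card sub.
  have c2 : #|w |: (U :&: [set z | e v z])| <= 1 + #|U :&: [set z | e v z]|.
    by rewrite cardsU1 leq_add2r leq_b1.
  have c3 : #|U| <= #|U :&: [set z | e v z]|.
    by rewrite cardU; move: kd c1 c2; rewrite /deg; clear; lia.
  have /eqP <- : U :&: [set z | e v z] == U by rewrite eqEcard subsetIl.
  by apply/forall_inP => u; rewrite !inE symE => /andP[].
case: (ltnP k (deg e x)) => dx; first by left; apply: key dx; eassumption.
right; apply: (key y x) => //; first by rewrite symE.
by have := deg2E exy; clear -dx; lia.
Qed.

(** By [outside_nbr_unique] two different edges avoiding [U] are disjoint. Each has a joined end,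
    which contradicts [joined_edges]. *)
Lemma outside_edge_unique x y x' y' : odd a -> odd b ->
  x \notin U -> y \notin U -> x' \notin U -> y' \notin U -> e x y -> e x' y' ->
  (x' = x /\ y' = y) \/ (x' = y /\ y' = x).
Proof.
move=> oa ob xU yU x'U y'U exy exy'.
have nb := outside_nbr_unique oa ob.
have eyx : e y x by rewrite symE.
have eyx' : e y' x' by rewrite symE.
have [E|n1] := eqVneq x' x; first by left; split => //; apply: (nb x) => //; rewrite -E.
have [E|n2] := eqVneq x' y; first by right; split => //; apply: (nb y) => //; rewrite -E.
have [E|n3] := eqVneq y' x.
  by case/eqP: n2; apply: (nb x) => //; rewrite -E.
have [E|n4] := eqVneq y' y.
  by case/eqP: n1; apply: (nb y) => //; rewrite -E.
have n5 : x != y by apply: contraTneq exy => ->; rewrite irrE.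
have n6 : x' != y' by apply: contraTneq exy' => ->; rewrite irrE.
exfalso.
have [jx|jy] := outside_edge_joined oa ob xU yU exy;
have [jx'|jy'] := outside_edge_joined oa ob x'U y'U exy'.
- apply: (@joined_edges x y x' y') => //.
  by rewrite /= !inE !negb_or n1 n2 n3 n4 n5 eq_sym n6.
- apply: (@joined_edges x y y' x') => //.
  by rewrite /= !inE !negb_or n1 n2 n3 n4 n5 n6.
- apply: (@joined_edges y x x' y') => //.
  by rewrite /= !inE !negb_or n1 n2 n3 n4 (eq_sym y) n5 eq_sym n6.
- apply: (@joined_edges y x y' x') => //.
  by rewrite /= !inE !negb_or n1 n2 n3 n4 (eq_sym y) n5 n6.
Qed.

End OutsideU.

(** * Edge counts and stable graphs *)

Definition adj (T : finType) (e : rel T) (A B : {set T}) : nat :=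
  \sum_(x in A) \sum_(y in B) e x y.

Lemma big_setC (T : finType) (F : T -> nat) (D : {set T}) :
  \sum_(x : T) F x = \sum_(x in D) F x + \sum_(x in ~: D) F x.
Proof.
rewrite (bigID (mem D)) /=; congr (_ + _).
by apply: eq_bigl => x; rewrite inE.
Qed.

Section Adj.
Variables (T : finType) (e : rel T).

Lemma deg_sum x : deg e x = \sum_(y : T) e x y.
Proof.
rewrite /deg -sum1_card big_mkcond /=.
by apply: eq_bigr => y _; rewrite inE; case: (e x y).
Qed.

Lemma adjTr (A : {set T}) : adj e A setT = \sum_(x in A) deg e x.
Proof.
apply: eq_bigr => x _; rewrite deg_sum; apply: eq_bigl => y; by rewrite inE.
Qed.

Lemma adj_setC (A D : {set T}) : adj e A setT = adj e A D + adj e A (~: D).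
Proof.
rewrite /adj -big_split; apply: eq_bigr => x _ /=.
by rewrite -big_setC; apply: eq_bigl => y; rewrite inE.
Qed.

Lemma adjT_setC (D : {set T}) :
  adj e setT setT = adj e D setT + adj e (~: D) setT.
Proof. by rewrite !adjTr -big_setC; apply: eq_bigl => x; rewrite inE. Qed.

Lemma adj_card (A B : {set T}) :
  adj e A B = #|[set p | [&& p.1 \in A, p.2 \in B & e p.1 p.2]]|.
Proof.
rewrite /adj pair_big_dep /= -sum1_card big_mkcond /= [RHS]big_mkcond /=.
apply: eq_bigr => -[x y] _; rewrite inE /=.
by case: (x \in A); case: (y \in B); case: (e x y).
Qed.

Lemma adj_leq_mul (A B : {set T}) : adj e A B <= #|A| * #|B|.
Proof.
rewrite -sum_nat_const; apply: leq_sum => x _.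
by rewrite -[#|B|]sum1_card; apply: leq_sum => y _; case: (e x y).
Qed.

Hypotheses (symE : symmetric e) (irrE : irreflexive e).

Lemma adjC (A B : {set T}) : adj e A B = adj e B A.
Proof.
rewrite /adj exchange_big; apply: eq_bigr => x _; apply: eq_bigr => y _.
by rewrite symE.
Qed.

Lemma deg_lt x : deg e x <= #|T|.-1.
Proof.
rewrite (cardD1 x) inE /=; apply: subset_leq_card; apply/subsetP => y.
by rewrite !inE andbT => exy; apply: contraTneq exy => ->; rewrite irrE.
Qed.

(** The edges lost with [D] number the degree sum over [D] minus the edges inside [D], which that
    sum counts twice. The form is doubled and free of subtraction. *)
Lemma adj_delete (D : {set T}) :
  adj e setT setT + adj e D D = adj e (~: D) (~: D) + 2 * \sum_(x in D) deg e x.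
Proof.
rewrite -adjTr (adjT_setC D) (adj_setC (~: D) D) (adj_setC D D) (adjC (~: D) D); lia.
Qed.

Lemma adj_inner (D : {set T}) : adj e D D <= #|D| * #|D|.-1.
Proof.
rewrite -sum_nat_const; apply: leq_sum => x xD.
rewrite (bigD1 x) //= irrE add0n (cardsD1 x D) xD /= -sum1_card.
rewrite [X in _ <= X](eq_bigl (fun y => (y \in D) && (y != x))); last first.
  by move=> y; rewrite !inE andbC.
by apply: leq_sum => y _; case: (e x y).
Qed.

End Adj.

(* The potential is scaled by 6, since [adj e A A] counts each edge of [A] twice. *)
Definition stable (T : finType) (e : rel T) (k : nat) := forall A : {set T},
  3 * adj e A A + (6 * k - 2) * #|~: A| <= 3 * adj e setT setT.

Section Stable.
Variables (T : finType) (e : rel T) (k : nat).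
Hypotheses (symE : symmetric e) (irrE : irreflexive e) (k0 : 0 < k).
Hypothesis stE : stable e k.

(** Deleting [x] shows that its degree is at least [k - 1/3], hence at least [k]. *)
Lemma stable_deg x : k <= deg e x.
Proof.
have := stE (~: [set x]); rewrite setCK cards1.
have := adj_delete symE [set x]; rewrite big_set1; clear -k0; lia.
Qed.

(** Deleting both ends loses one edge less than the degree sum, so the sum is at least
    [2 * k - 2/3 + 1]. An offset below [1/2] is what makes this exceed [2 * k]. *)
Lemma stable_deg2 x y : e x y -> 2 * k < deg e x + deg e y.
Proof.
move=> exy; have xy : x != y by apply: contraTneq exy => ->; rewrite irrE.
have := stE (~: [set x; y]); rewrite setCK cards2 xy.
have := adj_delete symE [set x; y]; rewrite big_setU1 ?inE //= big_set1.
have : 2 <= adj e [set x; y] [set x; y].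
  rewrite /adj !big_setU1 ?inE //= !big_set1 !big_setU1 ?inE //= !big_set1.
  by rewrite (symE y x) exy; lia.
clear -k0; lia.
Qed.

(** Deleting [m] vertices that form a union of components loses at most [m * (m - 1) / 2] edges, and
    at least [(k - 1/3) * m] by stability. *)
Lemma stable_closed (C : {set T}) : C != set0 ->
  (forall x y, x \in C -> e x y -> y \in C) -> 2 * k < #|C|.
Proof.
move=> /set0Pn[c cC] clC.
have E : adj e C setT = adj e C C.
  apply: eq_bigr => x xC; rewrite [LHS]big_mkcond [RHS]big_mkcond.
  apply: eq_bigr => y _; rewrite inE /=.
  by case: (boolP (y \in C)) => // yC; case: (boolP (e x y)) => // /(clC _ _ xC); rewrite (negbTE yC).
have := stE (~: C); rewrite setCK.
have := adj_delete symE C; rewrite -adjTr E.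
have := adj_inner irrE C.
have : 0 < #|C| by apply/card_gt0P; exists c.
move: (adj e C C) (adj e (~: C) (~: C)) (adj e _ _) #|C| => s s' s'' m m0 h1 h2 h3.
have h4 : (6 * k - 2) * m <= 3 * m.-1 * m by lia.
have : 6 * k - 2 <= 3 * m.-1 by rewrite -(leq_pmul2r m0).
clear -k0; lia.
Qed.

End Stable.

(** * From stability to the core set *)

Lemma long_path_split (T : finType) (e : rel T) a b s : 0 < a ->
  gpath e s -> a + b <= size s -> contains_PaPb e a b.
Proof.
move=> a0 gs sz.
have us : uniq (take a s ++ drop a s) by rewrite cat_take_drop; case/andP: gs.
apply: (contains_of_paths a0 (gpath_take a gs) (gpath_drop a gs)).
- by move: us; rewrite cat_uniq => /and3P[].
- by rewrite size_takel //; apply: leq_trans sz; apply: leq_addr.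
by rewrite size_drop; lia.
Qed.

(** Records which edges may avoid [U]; this suffices for the edge bound and, at equality, for the
    isomorphism. *)
Definition core_set (T : finType) (e : rel T) a b (U : {set T}) :=
  [/\ #|U| = (a./2 + b./2).-1,
   (~~ (odd a && odd b) -> forall x y, x \notin U -> y \notin U -> ~~ e x y) &
   (odd a && odd b -> forall x y x' y', x \notin U -> y \notin U ->
      x' \notin U -> y' \notin U -> e x y -> e x' y' ->
      (x' = x /\ y' = y) \/ (x' = y /\ y' = x))].

Lemma stable_core_set (T : finType) (e : rel T) a b k :
  symmetric e -> irreflexive e -> 2 <= b -> b < a -> k = (a./2 + b./2).-1 ->
  stable e k -> PaPb_free e a b ->
  2 * k + 3 + k.+1 * k.+1 * (k + 4) < #|T| ->
  exists U, core_set e a b U.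
Proof.
move=> symE irrE b2 ba kE stE freeE big.
have Ha := odd_double_half a; have Hb := odd_double_half b.
have k0 : 0 < k by clear -kE Ha Hb b2 ba; lia.
(* By these bounds [F] is contained in two disjoint paths on [2 * k + 1] and [k + 1] vertices, and
   in one path on [2 * k + 4] vertices. *)
have ak : a <= 2 * k + 1 by clear -kE Ha Hb b2 ba; lia.
have bk : b <= k.+1 by clear -kE Ha Hb b2 ba; lia.
have abk : a + b <= 2 * k + 4 by clear -kE Ha Hb b2 ba; lia.
have a0 : 0 < a by clear -ba; lia.
have degE := stable_deg symE k0 stE.
have deg2E := stable_deg2 symE irrE k0 stE.
have csym : connect_sym e by apply: sym_connect_sym.
pose C x := [set y | connect e x y].
have longC x : exists s, [/\ gpath e s, all (mem (C x)) s & 2 * k < size s].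
  have clC u v : u \in C x -> e u v -> v \in C x.
    by rewrite !inE => xu uv; apply: connect_trans xu (connect1 uv).
  apply: closed_long_path => //.
  - move=> u v; rewrite !inE => xu xv; apply: connect_trans xv.
    by rewrite csym.
  - apply: (stable_closed symE irrE k0 stE) => //.
    by apply/set0Pn; exists x; rewrite inE connect0.
have conE x y : connect e x y.
  apply/negPn/negP => nxy; apply: freeE.
  have [s [gs sC szs]] := longC x; have [s' [gs' sC' szs']] := longC y.
  apply: (contains_of_paths a0 gs gs').
  - apply/hasPn => z zs'; apply/negP => zs; case/negP: nxy.
    move/allP: sC => /(_ z zs); move/allP: sC' => /(_ z zs'); rewrite /= !inE => yz xz.
    by apply: connect_trans xz _; rewrite csym.
  - by clear -ak szs; lia.
  - by clear -bk szs'; lia.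
have /card_gt0P[x0 _] : 0 < #|T| by clear -big; lia.
have [s0 [gs0 _ szs0]] := longC x0.
have [|Q [gQ maxQ]] := @longest_exists T (gpath e) #|T| _ (@gpath_size T e).
  by exists s0.
have szQ : 2 * k < size Q by apply: leq_trans szs0 _; apply: maxQ.
have szQ' : size Q <= 2 * k + 3.
  rewrite leqNgt; apply/negP => h; apply: freeE; apply: (long_path_split a0 gQ).
  by clear -h abk; lia.
have shortP P : gpath e P -> ~~ has (mem Q) P -> size P <= k.
  move=> gP dP; rewrite leqNgt; apply/negP => h; apply: freeE.
  apply: (contains_of_paths a0 gQ gP dP); first by clear -ak szQ; lia.
  by clear -bk h; lia.
have ind := outside_edgeless symE irrE degE deg2E gQ maxQ szQ' shortP.
have [U [W [cU cW UW]]] := common_neighbourhood symE degE gQ maxQ szQ' ind big.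
have jW w : w \in W -> joined e U w by move=> wW; apply/joinedP => u uU; apply: UW.
(* The two zigzags need [k + 1], and up to four prescribed vertices must be avoided. *)
have cW' : k + 5 <= #|W| by clear -cW; lia.
exists U; split; first by rewrite cU.
  by move=> no x y; apply: (outside_edgeless_even symE irrE b2 ba kE cU cW' jW freeE conE no).
move=> /andP[oa ob] x y x' y'.
exact: (outside_edge_unique symE irrE b2 ba kE cU cW' jW freeE degE deg2E conE oa ob).
Qed.

(** * The extremal graph *)

(* Twice the number of edges of [G_F(n)]. *)
Definition max_adj (a b n : nat) :=
  let k := (a./2 + b./2).-1 in k * n.-1 + (n - k) * k + 2 * (odd a && odd b).

Lemma adj_geq2 (T : finType) (e : rel T) (A : {set T}) x y :
  symmetric e -> irreflexive e -> x \in A -> y \in A -> e x y -> 2 <= adj e A A.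
Proof.
move=> symE irrE xA yA exy; rewrite adj_card.
have xy : (x, y) != (y, x).
  by apply: contraTneq exy => -[-> _]; rewrite irrE.
have <- : #|[set (x, y); (y, x)]| = 2 by rewrite cards2 xy.
apply: subset_leq_card; apply/subsetP => p; rewrite !inE.
by case/orP => /eqP -> /=; rewrite xA yA // symE.
Qed.

Lemma index_cons2_eq0 (T : eqType) (x y v : T) r :
  (index v [:: x, y & r] == 0) = (v == x).
Proof. by rewrite /= [v == x]eq_sym; case: (x == v). Qed.

Lemma index_cons2_eq1 (T : eqType) (x y v : T) r : x != y ->
  (index v [:: x, y & r] == 1) = (v == y).
Proof.
move=> /= xy; have [<-|n] := eqVneq x v; first by rewrite (negbTE xy).
by rewrite [v == y]eq_sym; case: (y == v).
Qed.

Section CoreBound.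
Variables (T : finType) (e : rel T) (a b : nat) (U : {set T}).
Hypotheses (symE : symmetric e) (irrE : irreflexive e) (coreU : core_set e a b U).
Let k := (a./2 + b./2).-1.

Lemma core_outside_adj : adj e (~: U) (~: U) <= 2 * (odd a && odd b).
Proof.
case: coreU => _ He Ho; rewrite adj_card.
have [/existsP[[x y]]|] := boolP [exists p : T * T, [&& p.1 \notin U, p.2 \notin U & e p.1 p.2]].
  case/and3P=> /= xU yU exy; have o : odd a && odd b.
    by apply/negPn/negP => no; have := He no x y xU yU; rewrite exy.
  rewrite o; apply: (@leq_trans #|[set (x, y); (y, x)]|); last by rewrite cards2; case: (_ != _).
  apply: subset_leq_card; apply/subsetP => -[v w]; rewrite !inE /= => /and3P[vU wU evw].
  by case: (Ho o x y v w) => // -[-> ->]; rewrite eqxx ?orbT.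
rewrite negb_exists => /forallP H.
rewrite (_ : [set p | _] = set0) ?cards0 //; apply/setP => p; rewrite !inE.
exact/negbTE/H.
Qed.

Lemma core_adjE :
  adj e setT setT = \sum_(u in U) deg e u + adj e (~: U) U + adj e (~: U) (~: U).
Proof. by rewrite (adjT_setC e U) adjTr (adj_setC e (~: U) U) addnA. Qed.

Lemma core_bound : adj e setT setT <= max_adj a b #|T|.
Proof.
have [cU _ _] := coreU.
rewrite core_adjE /max_adj -/k leq_add ?core_outside_adj // leq_add //.
  by rewrite /k -cU -sum_nat_const; apply: leq_sum => u _; apply: deg_lt.
apply: leq_trans (adj_leq_mul _ _ _) _.
by rewrite cU -/k; have := cardsC U; rewrite cU -/k => <-; rewrite addKn.
Qed.

(** A non-neighbour of [u] lowers the degree sum over [U], and no other summand of [core_adjE] can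
    make up for it. *)
Lemma core_tight_join u v : max_adj a b #|T| <= adj e setT setT ->
  u \in U -> u != v -> e u v.
Proof.
move=> tight uU uv; apply/negPn/negP => nuv.
have [cU _ _] := coreU.
have cardC : #|~: U| = #|T| - k by have := cardsC U; rewrite cU -/k => <-; rewrite addKn.
have h1 : \sum_(w in U) deg e w < k * #|T|.-1.
  rewrite /k -cU -sum_nat_const (bigD1 u) //= [X in _ < X](bigD1 u) //= -addSn leq_add //.
    rewrite (cardD1 u) inE /= (cardD1 v) !inE eq_sym uv /= ltnS.
    apply: subset_leq_card; apply/subsetP => z; rewrite !inE andbT => euz.
    apply/andP; split; first by apply: contraTneq euz => ->.
    by apply: contraTneq euz => ->; rewrite irrE.
  by apply: leq_sum => w _; apply: deg_lt.
have h2 : adj e (~: U) U <= (#|T| - k) * k.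
  by apply: leq_trans (adj_leq_mul _ _ _) _; rewrite cU cardC.
have h3 := core_outside_adj.
by move: tight; rewrite core_adjE /max_adj -/k; clear -h1 h2 h3; lia.
Qed.

Lemma core_tight_edge : max_adj a b #|T| <= adj e setT setT -> odd a && odd b ->
  exists x y, [/\ x \notin U, y \notin U & e x y].
Proof.
move=> tight o; have [cU _ _] := coreU.
have cardC : #|~: U| = #|T| - k by have := cardsC U; rewrite cU -/k => <-; rewrite addKn.
have h1 : \sum_(w in U) deg e w <= k * #|T|.-1.
  by rewrite /k -cU -sum_nat_const; apply: leq_sum => w _; apply: deg_lt.
have h2 : adj e (~: U) U <= (#|T| - k) * k.
  by apply: leq_trans (adj_leq_mul _ _ _) _; rewrite cU cardC.
have : 0 < adj e (~: U) (~: U).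
  by move: tight; rewrite core_adjE /max_adj -/k o; clear -h1 h2; lia.
rewrite adj_card => /card_gt0P[[x y]]; rewrite !inE /= => /and3P[xU yU exy].
by exists x, y.
Qed.

(** The vertices are numbered with [U] first, then the ends of the edge avoiding [U] if [a] and [b]
    are odd, then the rest. *)
Lemma core_iso n : #|T| = n -> max_adj a b n <= adj e setT setT ->
  graph_iso e (GF_edge a b n).
Proof.
move=> cT; rewrite -cT => tight; have [cU He Ho] := coreU.
have join := core_tight_join tight.
have [c [uc dc cP]] : exists c : seq T, [/\ uniq c, ~~ has (mem U) c &
    if odd a && odd b then exists x y, [/\ c = [:: x; y] & e x y] else c = [::]].
  have [o|no] := boolP (odd a && odd b); last by exists [::].
  have [x [y [xU yU exy]]] := core_tight_edge tight o.
  exists [:: x; y]; split; last by exists x, y.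
    by rewrite /= inE andbT; apply: contraTneq exy => ->; rewrite irrE.
  by rewrite /= (negbTE xU) (negbTE yU).
pose l := enum U ++ c ++ enum (~: (U :|: [set z in c])).
have meml z : z \in l.
  rewrite !mem_cat !mem_enum !inE.
  by case: (z \in U); case: (z \in c).
have ltl z : index z l < #|T|.
  suff -> : #|T| = size l by rewrite index_mem.
  have ul : uniq l.
    rewrite !cat_uniq !enum_uniq uc andbT /= has_cat negb_or -andbA; apply/and3P; split.
    - by apply: contra dc => /hasP[v vc]; rewrite /= mem_enum => vU; apply/hasP; exists v.
    - by apply/hasPn => v; rewrite /= !mem_enum !inE negb_or => /andP[].
    - by apply/hasPn => v; rewrite /= !mem_enum !inE negb_or => /andP[].
  by rewrite -(card_uniqP ul); apply: eq_card => v; rewrite meml.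
pose f z := Ordinal (ltl z).
have injf : injective f.
  move=> z z' /(congr1 val) /= E.
  by rewrite -(nth_index z (meml z)) E nth_index.
exists f; split; first by apply: inj_card_bij; rewrite ?card_ord.
have fU z : (f z < k) = (z \in U).
  rewrite /= index_cat mem_enum; case: ifP => zU.
    by rewrite /k -cU cardE index_mem mem_enum.
  by rewrite -cardE cU -/k ltnNge leq_addr.
have fx z i : z \notin U -> (f z == k + i :> nat) = (index z (c ++ enum (~: (U :|: [set z in c]))) == i).
  by move=> zU; rewrite /= index_cat mem_enum (negbTE zU) -cardE cU -/k eqn_add2l.
move=> z z'; rewrite /GF_edge -/k (inj_eq injf) !fU.
have [<-|zz'] := eqVneq z z'; first by rewrite irrE.
have [zU|zU] := boolP (z \in U); first by rewrite join.
have [z'U|z'U] := boolP (z' \in U); first by rewrite symE join // eq_sym.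
rewrite /=; case: ifP cP => [o [x [y [cE exy]]]|no _] /=; last first.
  by rewrite (negbTE (He _ z z' zU z'U)) ?no.
have xU : x \notin U by move: dc; rewrite cE /=; case: (x \in U).
have yU : y \notin U by move: dc; rewrite cE /= orbF; case: (y \in U); rewrite ?orbT.
have xy : x != y by apply: contraTneq exy => ->; rewrite irrE.
have fz v : v \notin U -> (index v l == k) = (v == x).
  by move=> vU; rewrite -[k]addn0 -[index v l]/(nat_of_ord (f v)) fx // cE index_cons2_eq0.
have fz' v : v \notin U -> (index v l == k.+1) = (v == y).
  by move=> vU; rewrite -addn1 -[index v l]/(nat_of_ord (f v)) fx // cE index_cons2_eq1.
rewrite !fz // !fz' //.
apply/idP/idP => [/orP[]/andP[/eqP -> /eqP ->] //|ezz]; first by rewrite symE.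
by case: (Ho o x y z z' xU yU zU z'U exy ezz) => -[-> ->]; rewrite !eqxx ?orbT.
Qed.

End CoreBound.

(** * The edge count of the extremal graph *)

Lemma GF_edge_sym a b n : symmetric (GF_edge a b n).
Proof.
move=> i j; rewrite /GF_edge eq_sym orbCA; congr (_ && [|| _, _ | _ && _]).
by rewrite orbC; congr (_ || _); rewrite andbC.
Qed.

Lemma GF_edge_irr a b n : irreflexive (GF_edge a b n).
Proof. by move=> i; rewrite /GF_edge eqxx. Qed.

Lemma GF_edge_adj a b n : (a./2 + b./2).-1.+1 < n ->
  max_adj a b n <= adj (GF_edge a b n) setT setT.
Proof.
set k := (a./2 + b./2).-1 => kn.
have kn' : k <= n by lia.
pose U := [set i : 'I_n | i < k].
have cU : #|U| = k.
  have -> : U = [set widen_ord kn' j | j : 'I_k].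
    apply/setP => i; rewrite inE; apply/idP/imsetP => [ik|[j _ ->]]; last exact: (ltn_ord j).
    by exists (Ordinal ik) => //; apply: val_inj.
  by rewrite card_imset ?card_ord // => i j /(congr1 val) /= /val_inj.
have cC : #|~: U| = n - k by have := cardsC U; rewrite card_ord cU => h; clear -h; lia.
rewrite (core_adjE _ U) /max_adj -/k leq_add ?leq_add //.
- rewrite -cU -sum_nat_const; apply: leq_sum => i; rewrite inE => ik.
  have -> : n.-1 = #|predC1 i| by rewrite cardC1 card_ord.
  apply: subset_leq_card.
  by apply/subsetP => j; rewrite !inE /GF_edge -/k ik eq_sym => ->.
- rewrite -cC -[X in _ * X]cU -sum_nat_const; apply: leq_sum => i; rewrite !inE => ik.
  rewrite -sum1_card; apply: leq_sum => j; rewrite inE => jk.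
  rewrite /GF_edge -/k jk orbT andbT.
  by have -> : i != j by apply: contraNneq ik => ->.
have [o|] := boolP (odd a && odd b); last by rewrite muln0.
have k1 : k < n by lia.
apply: (@adj_geq2 _ _ _ (Ordinal k1) (Ordinal kn)).
- exact: GF_edge_sym.
- exact: GF_edge_irr.
- by rewrite !inE /= ltnn.
- by rewrite !inE /= -leqNgt leqnSn.
rewrite /GF_edge -/k o /= !eqxx !orbT andbT.
by apply/eqP => /(congr1 val) /=; lia.
Qed.

(** Since [edge_count] halves with rounding, evenness is what carries an equality of halves back to
    a bound by [max_adj]. *)
Lemma max_adj_even a b n : (a./2 + b./2).-1 <= n -> ~~ odd (max_adj a b n).
Proof.
rewrite /max_adj; set k := _.-1 => kn.
rewrite oddD mul2n odd_double addbF oddD !oddM oddB //.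
case: n kn => [|n] kn; first by move: kn; rewrite leqn0 => /eqP ->.
by rewrite /=; case: (odd k); case: (odd n).
Qed.

Lemma double_mul_pred k n : 0 < n -> k <= n ->
  k * n.-1 + (n - k) * k + k + k * k = 2 * (k * n).
Proof.
move=> n0 kn; have e1 : k * n.-1 + k = k * n by rewrite -mulnSr prednK.
have e2 : (n - k) * k + k * k = k * n by rewrite -mulnDl subnK // mulnC.
by clear -e1 e2; lia.
Qed.

(** * Size estimates and the choice of [S] *)

Lemma leq_bin a j : 0 < j < a -> a <= 'C(a, j).
Proof.
elim: a j => [|a IH] [|j] // /andP[_]; rewrite ltnS => ja.
rewrite binS; move: ja; rewrite leq_eqVlt => /orP[/eqP <-|ja].
  by rewrite binn binSn add1n.
have h1 : a <= 'C(a, j.+1) by apply: IH.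
have h2 : 0 < 'C(a, j) by rewrite bin_gt0 ltnW // ltnW.
lia.
Qed.

Lemma adj_val (T : finType) (e : rel T) (S : {set T}) (A : {set {x | x \in S}}) :
  adj (relpre val e) A A = adj e (val @: A) (val @: A).
Proof.
rewrite /adj big_imset /=; last by move=> x y _ _; apply: val_inj.
apply: eq_bigr => x _; rewrite big_imset //=.
by move=> y z _ _; apply: val_inj.
Qed.

Lemma free_val (T : finType) (e : rel T) (S : {set T}) a b :
  PaPb_free e a b -> PaPb_free (relpre (val : {x | x \in S} -> T) e) a b.
Proof.
move=> fr [f [injf H]]; apply: fr; exists (fun i => val (f i)); split.
  by move=> i j /val_inj /injf.
by move=> i j /H.
Qed.

(** The inequality on [s] is the one that maximality of the potential gives for [#|S|]; it also
    holds for [s = n]. If [s] were at most the cubic bound, then [s <= 2 * a ^ 3], so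
    [2 * n <= 15 * a ^ 6], against [n >= 16 * a ^ 6]. *)
Lemma threshold_large a b k n s : 2 <= b -> b < a -> k = (a./2 + b./2).-1 ->
  'C(a, a./2) ^ 2 * a ^ 4 * b ^ 4 <= n ->
  2 * n <= 3 * (s * s) + 3 * k + 3 * (k * k) ->
  2 * k + 3 + k.+1 * k.+1 * (k + 4) < s.
Proof.
move=> b2 ba kE nbig sbig.
have Ha := odd_double_half a; have Hb := odd_double_half b.
have ka : k + 2 <= a by clear -kE Ha Hb b2 ba; lia.
have Ca : a <= 'C(a, a./2) by apply: leq_bin; clear -Ha b2 ba; lia.
have big : a ^ 2 * a ^ 4 * 2 ^ 4 <= n.
  by apply: leq_trans nbig; rewrite !leq_mul // leq_exp2r.
rewrite ltnNge; apply/negP => sle.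
have s2 : s <= 2 * (a * a * a).
  apply: (leq_trans sle).
  have : k.+2 * k.+2 * k.+2 <= a * a * a by rewrite !leq_mul // -addn2.
  clear; nia.
have s3 : s * s <= 4 * a ^ 6.
  rewrite (_ : 4 * a ^ 6 = (2 * (a * a * a)) * (2 * (a * a * a))) ?leq_mul //.
  by rewrite !expnS expn0; clear; lia.
have s4 : k + k * k <= a ^ 6.
  have h : k.+1 * k.+1 <= a ^ 2 by rewrite -mulnn leq_mul //; clear -ka; lia.
  apply: (@leq_trans (a ^ 2)); first by clear -h; nia.
  by rewrite leq_pexp2l //; clear -ka; lia.
have a6 : 0 < a ^ 6 by rewrite expn_gt0; clear -ka; lia.
by move: big; rewrite -expnD; clear -s3 s4 a6 sbig; lia.
Qed.

(** The graph induced on a maximiser [S] is stable and large, so it has a core set and obeys the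
    edge bound; this forces [S] to be everything. *)
Lemma dense_stable (T : finType) (e : rel T) a b k :
  symmetric e -> irreflexive e -> 2 <= b -> b < a -> k = (a./2 + b./2).-1 ->
  'C(a, a./2) ^ 2 * a ^ 4 * b ^ 4 <= #|T| -> PaPb_free e a b ->
  max_adj a b #|T| <= adj e setT setT -> stable e k.
Proof.
move=> symE irrE b2 ba kE nbig freeE dense.
have Ha := odd_double_half a; have Hb := odd_double_half b.
have k0 : 0 < k by clear -kE Ha Hb b2 ba; lia.
set n := #|T| in nbig dense.
(* Six times the potential of the overview, shifted by a constant so that no negative term
   occurs. *)
pose pot (S : {set T}) := 3 * adj e S S + (6 * k - 2) * (n - #|S|).
case: (@arg_maxnP _ setT xpredT pot isT) => S _ maxS.
have cS : #|S| <= n by apply: max_card.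
have pS : 3 * adj e setT setT <= pot S.
  by have : pot setT <= pot S := maxS setT isT; rewrite {1}/pot cardsT subnn muln0 addn0.
have nlarge : 2 * k + 3 + k.+1 * k.+1 * (k + 4) < n.
  by apply: (threshold_large b2 ba kE nbig); clear; case: n => [|m]; nia.
have [kn n0] : k <= n /\ 0 < n by clear -nlarge; lia.
have cost m : (6 * k - 2) * m + 2 * m = 6 * (k * m).
  by rewrite -mulnDl subnK ?mulnA //; clear -k0; lia.
have dense3 : 3 * (k * n.-1 + (n - k) * k) <= pot S.
  apply: leq_trans pS; rewrite leq_mul2l /=; apply: leq_trans dense.
  by rewrite /max_adj -kE leq_addr.
have bigS : 2 * k + 3 + k.+1 * k.+1 * (k + 4) < #|S|.
  apply: (threshold_large b2 ba kE nbig).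
  have := adj_leq_mul e S S; move: dense3; rewrite /pot.
  move: (adj e S S) #|S| cS => x s sn h1 h2.
  have h3 : (6 * k - 2) * (n - s) <= (6 * k - 2) * n by rewrite leq_mul2l leq_subr orbT.
  have := cost n; have := double_mul_pred n0 kn; clear -h1 h2 h3; lia.
pose T' : finType := {x | x \in S}; pose e' : rel T' := relpre val e.
have cT' : #|T'| = #|S| by rewrite card_sig.
have imT : val @: [set: T'] = S.
  apply/setP => x; apply/imsetP/idP => [[y _ ->]|xS]; first exact: valP.
  by exists (Sub x xS).
have stE' : stable e' k.
  move=> A; rewrite /e' !adj_val imT.
  have : pot (val @: A) <= pot S := maxS (val @: A) isT; rewrite /pot card_imset; last exact: val_inj.
  have := cardsC A; rewrite cT' => cA.
  have -> : n - #|A| = (n - #|S|) + #|~: A| by clear -cA cS; lia.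
  by rewrite mulnDr addnCA [X in _ <= X]addnC leq_add2l.
have [U coreU] : exists U, core_set e' a b U.
  apply: (stable_core_set _ _ b2 ba kE stE').
  - by move=> x y; apply: symE.
  - by move=> x; apply: irrE.
  - exact: free_val.
  - by rewrite cT'.
have := core_bound (fun x => irrE (val x)) coreU; rewrite /e' adj_val imT cT' => bS.
(* Each further vertex raises [max_adj] by [2 * k], hence three times it by [6 * k], while a vertex
   outside [S] contributes only [6 * k - 2] to [pot S]. *)
have Sn : #|S| = n.
  have [ks s0] : k <= #|S| /\ 0 < #|S| by clear -bigS; lia.
  move: dense pS bS; rewrite /max_adj -kE /pot.
  move: (2 * _) => o h1 h2 h3.
  have e1 := double_mul_pred n0 kn; have e2 := double_mul_pred s0 ks.
  have e3 := cost (n - #|S|).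
  have e4 : k * n = k * #|S| + k * (n - #|S|) by rewrite -mulnDr subnKC.
  by clear -h1 h2 h3 e1 e2 e3 e4 cS; lia.
have ST : S = setT by apply/eqP; rewrite eqEcard subsetT cardsT -/n Sn /=.
move=> A; have : pot A <= pot S := maxS A isT; rewrite /pot ST cardsT subnn muln0 addn0.
by have := cardsC A; rewrite -/n => <-; rewrite addKn.
Qed.

Theorem theorem2p2 (a b n : nat) (T : finType) (e : rel T) :
  (2 <= b)%N -> (b < a)%N ->
  simple_graph e -> #|T| = n ->
  ('C(a, a./2) ^ 2 * a ^ 4 * b ^ 4 <= n)%N ->
  PaPb_free e a b ->
  (edge_count e <= edge_count (GF_edge a b n))%N /\
  (edge_count e = edge_count (GF_edge a b n) -> graph_iso e (GF_edge a b n)).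
Proof.
move=> b2 ba [symE irrE] cT nbig freeE.
have ecE (T' : finType) (e' : rel T') : edge_count e' = (adj e' setT setT)./2.
  by rewrite /edge_count adj_card; congr _./2; apply: eq_card => p; rewrite !inE.
rewrite !ecE.
set k := (a./2 + b./2).-1.
have big : 2 * k + 3 + k.+1 * k.+1 * (k + 4) < n.
  by apply: (threshold_large b2 ba (erefl k) nbig); clear; case: n => [|m]; nia.
have kn : k <= n by clear -big; lia.
have GFlow : max_adj a b n <= adj (GF_edge a b n) setT setT.
  by apply: GF_edge_adj; rewrite -/k; clear -big; lia.
have core : max_adj a b n <= adj e setT setT -> exists U, core_set e a b U.
  move=> dense; apply: (stable_core_set symE irrE b2 ba (erefl k)) => //.
    by apply: (dense_stable symE irrE b2 ba) => //; rewrite cT.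
  by rewrite cT.
split.
  apply: half_leq; case: (leqP (max_adj a b n) (adj e setT setT)) => [/core[U coreU]|lt].
    by apply: leq_trans GFlow; rewrite -cT; apply: core_bound coreU.
  by apply: leq_trans (ltnW lt) GFlow.
(* As [max_adj] is even, the rounding in the halves loses nothing. *)
move=> Eh; have dense : max_adj a b n <= adj e setT setT.
  have := half_leq GFlow; rewrite -Eh.
  have := odd_double_half (max_adj a b n); rewrite (negbTE (max_adj_even kn)).
  have := odd_double_half (adj e setT setT); clear; lia.
have [U coreU] := core dense.
exact: (core_iso symE irrE coreU cT dense).
Qed.
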